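(* For any $b\ge2$, $i\in I$ and $n\ge2$, there are integers $c,k$ with $1\le c\le b-1$ and $0\le k\le(b-1)B(n)-2$ such that $K_i(n)=c\,(b^{B(n)}+1)+k$. Furthermore, if $b$ is odd then $c\le\frac{b-1}{2}$.
   Context: Fix a base $b\ge2$. For $v\in\mathbb{N}$, $s(v)$ is the sum of the base-$b$ digits of $v$, $f(v)=v+s(v)$, and $F(u)=|\{v\in\mathbb{N}: f(v)=u\}|$. $K(n)$ is the smallest $u\in\mathbb{N}$ with $F(u)=n$, and for $n\ge2$, $B(n)=\lfloor\log_b K(n)\rfloor$ (so $K(n)=b^{B(n)}+$ lower-order terms). The index set $I$ is the set of residue classes modulo $b-1$ if $b$ is even, and the set of even residue classes $\{0,2,4,\dots,b-3\}$ modulo $b-1$ if $b$ is odd. For $i\in I$, $K_i(n)$ is the smallest $u\in\mathbb{N}$ with $F(u)=n$ and $u\equiv i\pmod{b-1}$. *)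

(* Defs.v *)
From mathcomp Require Import all_boot finmap.
From mathcomp Require Import boolp classical_sets functions cardinality.

Set Implicit Arguments.
Unset Strict Implicit.
Unset Printing Implicit Defensive.

Local Open Scope nat_scope.
Local Open Scope classical_set_scope.

Definition digit_sum (b v : nat) : nat :=
  \sum_(j < (trunc_log b v).+1) (v %/ b ^ j) %% b.

Definition gen (b v : nat) : nat := v + digit_sum b v.

Lemma finite_generators (b u : nat) : finite_set [set v | gen b v = u].
Proof.
apply: (sub_finite_set _ (finite_II u.+1)) => v /= <-.
by rewrite ltnS leq_addr.
Qed.

Definition num_gen (b u : nat) : nat :=
  #|` fset_set [set v | gen b v = u] |%fset.

(* [least P] is 0 when [P] is empty.  This default satisfies no equation
   [least P = c * (b ^ e + 1) + k] with [1 <= c], and as [trunc_log b 0 = 0] it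
   leaves no [k] with [k + 2 <= b.-1 * trunc_log b (least P)]; so such relations
   also assert that the minimum exists. *)
Definition least (P : set nat) : nat :=
  xget 0 [set u | P u /\ forall v, P v -> u <= v].

Definition K (b n : nat) : nat := least [set u | num_gen b u = n].

Definition B (b n : nat) : nat := trunc_log b (K b n).

(* Residue classes modulo [b - 1] are given by their representatives in
   [{0, ..., b - 2}]; for [b = 2] there is the single class 0 modulo 1. *)
Definition index_set (b : nat) : {set 'I_b.-1} :=
  [set i : 'I_b.-1 | odd b ==> ~~ odd i]%SET.

Definition Ki (b : nat) (i : 'I_b.-1) (n : nat) : nat :=
  least [set u | num_gen b u = n /\ u = i %[mod b.-1]].

(* Main.v *)
Require Import Defs.
From mathcomp Require Import all_boot finmap.
From mathcomp Require Import boolp classical_sets functions cardinality.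
From mathcomp Require Import zify.

Set Implicit Arguments.
Unset Strict Implicit.
Unset Printing Implicit Defensive.

(** The generators of [c * (b ^ m + 1) + k] have top digit [c] or [c - 1], so
    their number depends only on [m] and [k]. Varying [c] reaches every residue
    class in the index set at the same scale [m], and minimality of [K] and [Ki]
    forces both onto the smallest scale at which [n] generators occur. *)

(** * Digit sums, top digits and digit complements *)

Lemma digit_sum_ltn_exp b m v : 1 < b -> v < b ^ m ->
  digit_sum b v = \sum_(j < m) (v %/ b ^ j) %% b.
Proof.
move=> b1; rewrite /digit_sum; have := trunc_log_ltn v b1.
move: (trunc_log b v).+1 => l.
have widen p q : p <= q -> v < b ^ p ->
    \sum_(j < p) (v %/ b ^ j) %% b = \sum_(j < q) (v %/ b ^ j) %% b.
  move=> pq vp; rewrite (big_ord_widen _ (fun j => (v %/ b ^ j) %% b) pq).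
  rewrite big_mkcond; apply: eq_bigr => j _; case: ltnP => // pj.
  by rewrite divn_small ?mod0n // (leq_trans vp) // leq_exp2l.
move=> vl vm; case/orP: (leq_total l m) => [lm | ml]; first exact: widen.
by rewrite (widen m l).
Qed.

Lemma digit_sum_cons_top b m d w : 1 < b -> d < b -> w < b ^ m ->
  digit_sum b (d * b ^ m + w) = d + digit_sum b w.
Proof.
move=> b1 db wm; have bm0 : 0 < b ^ m by rewrite expn_gt0 (ltnW b1).
rewrite (@digit_sum_ltn_exp b m.+1) //; last first.
  by rewrite expnS (@leq_trans (d.+1 * b ^ m)) ?leq_mul2r ?db ?orbT // mulSn addnC ltn_add2r.
rewrite big_ord_recr /= divnMDl // (divn_small wm) addn0 (modn_small db) addnC.
rewrite (digit_sum_ltn_exp b1 wm); congr (_ + _); apply: eq_bigr => j _.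
have -> : d * b ^ m = d * b ^ (m - j.+1) * b * b ^ j.
  by rewrite -!mulnA -expnS -expnD; congr (_ * _ ^ _); have := ltn_ord j; lia.
by rewrite divnMDl ?expn_gt0 ?(ltnW b1) // modnMDl.
Qed.

Lemma gen_cons_top b m d w : 1 < b -> d < b -> w < b ^ m ->
  gen b (d * b ^ m + w) = d * (b ^ m + 1) + gen b w.
Proof. by move=> b1 db wm; rewrite /gen digit_sum_cons_top //; lia. Qed.

Lemma digit_sum_small b v : v < b -> digit_sum b v = v.
Proof.
case: v => [|v] vb; first by rewrite /digit_sum big1 // => j _; rewrite div0n mod0n.
have b1 : 1 < b by lia.
by rewrite (@digit_sum_ltn_exp b 1) // big_ord1 expn0 divn1 modn_small.
Qed.

Lemma digit_sum_gt0 b v : 1 < b -> 0 < v -> 0 < digit_sum b v.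
Proof.
move=> b1 v0; have /andP[lo hi] := trunc_log_bounds b1 v0.
rewrite /digit_sum big_ord_recr /= modn_small.
  by rewrite ltn_addl // divn_gt0 // expn_gt0 (ltnW b1).
by rewrite ltn_divLR ?expn_gt0 ?(ltnW b1) // -expnS.
Qed.

Lemma expnS_split b m v : 1 < b -> v < b ^ m.+1 ->
  exists d w, [/\ d < b, w < b ^ m & v = d * b ^ m + w].
Proof.
move=> b1 vm; have bm0 : 0 < b ^ m by rewrite expn_gt0 (ltnW b1).
exists (v %/ b ^ m), (v %% b ^ m); split; last exact: divn_eq.
- by rewrite ltn_divLR // -expnS.
- by rewrite ltn_mod.
Qed.

(** Subtracting from [b ^ m - 1] never borrows: each of the [m] digits [d], leading zeros included,
    becomes [b.-1 - d]. *)
Lemma digit_sum_complement b m w : 1 < b -> w < b ^ m ->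
  digit_sum b w + digit_sum b (b ^ m - 1 - w) = b.-1 * m.
Proof.
move=> b1; elim: m w => [|m IH] w.
  rewrite expn0 ltnS leqn0 => /eqP->.
  by rewrite subnn sub0n digit_sum_small ?muln0 // ltnW.
case/(expnS_split b1) => d [x [db xm ->]].
have -> : b ^ m.+1 - 1 - (d * b ^ m + x) = (b.-1 - d) * b ^ m + (b ^ m - 1 - x).
  by rewrite expnS; nia.
by rewrite !digit_sum_cons_top ?mulnS -?(IH x) //; lia.
Qed.

Lemma gen_complement b m w : 1 < b -> w < b ^ m ->
  gen b w + gen b (b ^ m - 1 - w) + 1 = b ^ m + b.-1 * m.
Proof. by move=> b1 wm; rewrite /gen -(digit_sum_complement b1 wm); lia. Qed.

(** Powers of an odd [b] are odd, so peeling off a top digit removes a multiple of the even number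
    [b ^ m + 1]. *)
Lemma gen_even b v : 1 < b -> odd b -> ~~ odd (gen b v).
Proof.
move=> b1 ob; have : v < b ^ v by apply: ltn_expl.
move: {2}v => m; elim: m v => [|m IH] v.
  by rewrite expn0 ltnS leqn0 => /eqP->; rewrite /gen digit_sum_small // ltnW.
case/(expnS_split b1) => d [w [db wm ->]].
by rewrite gen_cons_top // oddD oddM oddD oddX ob orbT andbF IH.
Qed.

(** Puts every index with [k + 2 <= b.-1 * m] inside the range [k <= b ^ m] required by
    [num_gen_junction]. *)
Lemma bernoulli b m : 1 < b -> b.-1 * m < b ^ m.
Proof. by move=> b1; elim: m => [|m IH]; rewrite ?muln0 // expnS; nia. Qed.

(** * Counting generators at junctions *)

(** A positive [v] satisfies [v < gen b v], so its image exceeds any bound that [v] reaches; [0 < N]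
    retains the generator 0 of 0. *)
Lemma num_gen_sum b u N : 1 < b -> 0 < N -> u <= N ->
  num_gen b u = \sum_(v < N) (gen b v == u).
Proof.
move=> b1 N0 uN.
have -> : \sum_(v < N) (gen b v == u) = size [seq v <- iota 0 N | gen b v == u].
  by rewrite size_filter -sum1_count -(big_mkord xpredT (fun v => nat_of_bool (gen b v == u)))
             [in RHS]big_mkcond /index_iota subn0; apply: eq_bigr => v _; case: eqP.
apply/perm_size/uniq_perm; rewrite ?fset_uniq ?filter_uniq ?iota_uniq // => v.
rewrite in_fset_set; last exact: finite_generators.
rewrite mem_filter mem_iota add0n /=.
apply/idP/andP => [/set_mem /= vu | [/eqP vu _]]; last exact/mem_set.
rewrite vu; split=> //; rewrite ltnNge; apply/negP => Nv.
by have := digit_sum_gt0 b1 (leq_trans N0 Nv); move: vu; rewrite /gen; lia.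
Qed.

(** On one-digit numbers [gen] is doubling. *)
Lemma num_gen_le_base b u : 1 < b -> u <= b -> num_gen b u = ~~ odd u.
Proof.
move=> b1 ub; rewrite (num_gen_sum b1 (ltnW b1) ub).
have small (v : 'I_b) : gen b v = v.*2 by rewrite /gen digit_sum_small // addnn.
case: (boolP (odd u)) => ou /=.
  by apply: big1 => v _; rewrite small; case: eqP => // vu; rewrite -vu odd_double in ou.
have hb : u./2 < b by lia.
rewrite (bigD1 (Ordinal hb)) // small big1 => [|v nv]; first by rewrite /=; lia.
rewrite small; by apply/eqP; rewrite eqb0; apply: contraNneq nv => vu; apply/eqP/val_inj => /=; lia.
Qed.

Lemma num_gen_odd b u : 1 < b -> odd b -> odd u -> num_gen b u = 0.
Proof.
move=> b1 ob ou; rewrite (@num_gen_sum b u u) //; last by case: u ou.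
by apply: big1 => v _; case: eqP => // vu; have := gen_even v b1 ob; rewrite vu ou.
Qed.

(* The generators of [c * (b ^ m + 1) + k] below [b ^ m.+1] have top digit [c]
   or [c - 1]; complementing the lower digits of the latter turns them into
   generators of [b.-1 * m - 2 - k]. *)
Definition junction b m k :=
  num_gen b k + (if k + 2 <= b.-1 * m then num_gen b (b.-1 * m - 2 - k) else 0).

Lemma num_gen_junction b m c k : 1 < b -> 0 < c < b -> k <= b ^ m ->
  c * (b ^ m + 1) + k <= b ^ m.+1 ->
  num_gen b (c * (b ^ m + 1) + k) = junction b m k.
Proof.
move=> b1 /andP[c0 cb] kb le_u; have bm0 : 0 < b ^ m by rewrite expn_gt0 (ltnW b1).
have bern := bernoulli m b1.
set u := c * _ + k in le_u *.
pose G d := \sum_(w < b ^ m) (d * (b ^ m + 1) + gen b w == u).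
have -> : num_gen b u = \sum_(d < b) G d.
  rewrite (num_gen_sum b1 _ le_u) ?expn_gt0 ?(ltnW b1) //.
  rewrite -(big_mkord xpredT (fun v => nat_of_bool (gen b v == u))) expnS big_nat_mul big_mkord.
  apply: eq_bigr => d _; rewrite /G -{1}[d * b ^ m]add0n big_addn mulSn addnK big_mkord.
  by apply: eq_bigr => w _; rewrite addnC gen_cons_top.
have c'b : c.-1 < b by lia.
rewrite (bigD1 (Ordinal cb)) //= (bigD1 (Ordinal c'b)) /=; last by rewrite -val_eqE /=; lia.
rewrite [X in _ + (_ + X)]big1 => [|d /andP[/eqP dc /eqP dc']]; last first.
  have {}dc : d <> c :> nat by move=> e; apply/dc/val_inj.
  have {}dc' : d <> c.-1 :> nat by move=> e; apply/dc'/val_inj.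
  apply: big1 => w _; have := gen_complement b1 (ltn_ord w).
  case: eqP => // e _; move: e; rewrite /u.
  (* A top digit at most [c - 2] would need [gen b w] above [2 * b ^ m], against [gen_complement]
     and [bernoulli]; a top digit above [c] overshoots because [k <= b ^ m]. *)
  have [lt_dc | lt_cd] : d + 2 <= c \/ c + 1 <= d by lia.
    by have := gen_complement b1 (ltn_ord w); nia.
  by nia.
rewrite addn0 /junction; congr (_ + _).
  rewrite (num_gen_sum b1 bm0 kb); apply: eq_bigr => w _.
  by rewrite /u eqn_add2l.
(* By [gen_complement], the right-hand equation says that the complement of [w] generates
   [b.-1 * m - 2 - k], which is impossible when this difference is negative. *)
have uE w : (c.-1 * (b ^ m + 1) + gen b w == u) = (gen b w == b ^ m + 1 + k).
  by rewrite /u; case: (c) c0 => // c' _; rewrite mulSn; lia.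
case: ifP => [hk | /negbT hk]; last first.
  by apply: big1 => w _; rewrite uE; have := gen_complement b1 (ltn_ord w); lia.
rewrite (@num_gen_sum b _ (b ^ m)) //; last by lia.
rewrite /G (reindex_inj rev_ord_inj); apply: eq_bigr => w _; rewrite uE /=.
by rewrite -subn1 -[w.+1]addn1 addnC subnDA; have := gen_complement b1 (ltn_ord w); lia.
Qed.

(** * Junction decompositions and residues modulo [b - 1] *)

Lemma junction_decomposition b u : 1 < b -> 1 < u ->
  exists c m k, [/\ 0 < c < b, k <= b ^ m, u = c * (b ^ m + 1) + k & u <= b ^ m.+1].
Proof.
(* The logarithm of [u.-1] gives [b ^ m + 1 <= u <= b ^ m.+1], so that the quotient by [b ^ m + 1]
   is positive and below [b]. *)
move=> b1 u1; have /andP[lo hi] := @trunc_log_bounds b u.-1 b1 ltac:(lia).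
set m := trunc_log b u.-1 in lo hi; rewrite expnS in hi.
exists (u %/ (b ^ m + 1)), m, (u %% (b ^ m + 1)).
have d0 : 0 < b ^ m + 1 by rewrite addn1.
split; last by rewrite expnS; lia.
- by rewrite divn_gt0 // ltn_divLR //; nia.
- by have := ltn_pmod u d0; lia.
- exact: divn_eq.
Qed.

Lemma junction_residue b m c k : 1 < b ->
  c * (b ^ m + 1) + k = c * 2 + k %[mod b.-1].
Proof.
move=> b1; have := predn_exp b m; set q := \sum_(_ < _) _ => bE.
have -> : c * (b ^ m + 1) + k = c * q * b.-1 + (c * 2 + k).
  have bm0 : 0 < b ^ m by rewrite expn_gt0 (ltnW b1).
  by have -> : b ^ m = b.-1 * q + 1; [lia | nia].
by rewrite modnMDl.
Qed.

(** Doubling permutes the residues modulo an odd [b.-1]. Modulo an even [b.-1] it covers the even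
    residues, and half of the digits already suffice. *)
Lemma exists_leading_digit b i k : 1 < b -> (odd b -> ~~ odd i /\ ~~ odd k) ->
  exists c, [/\ 0 < c < b, odd b -> c <= b.-1./2 & c * 2 + k = i %[mod b.-1]].
Proof.
move=> b1 parity; set q := b.-1; have q0 : 0 < q by rewrite /q; lia.
(* [s] represents [i - k] modulo [q] without a truncated subtraction. *)
pose s := i + (q * k - k); have sk : s + k = k * q + i.
  by rewrite /s -addnA subnK ?leq_pmull // addnC mulnC.
pose r := s %% q; have rq : r < q by rewrite ltn_mod.
suff [c [c_lt c_half [t ct]]] : exists c,
    [/\ 0 < c < b, odd b -> c <= q./2 & exists t, c * 2 = t * q + r].
  exists c; split=> //.
  by rewrite ct -addnA modnMDl /r modnDml sk modnMDl.
have sE := divn_eq s q; rewrite -/r in sE.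
(* The multiple [t * q] makes [t * q + r] even and, as [c = 0] is excluded, positive. *)
case: (boolP (odd b)) => ob.
  have [oi ok] := parity ob.
  have oq : odd q = false by rewrite /q; lia.
  have or : ~~ odd r.
    have : odd (s + k) = odd (k * q + i) by rewrite sk.
    by rewrite {1}sE !oddD !oddM oq !andbF (negbTE oi) (negbTE ok) !addFb addbF => ->.
  have [r0 | r0] := posnP r.
    by exists q./2; split=> [| |]; [lia | by [] | exists 1; lia].
  by exists r./2; split=> [| |]; [lia | lia | exists 0; lia].
have oq : odd q by rewrite /q; lia.
case: (boolP (odd r)) => or.
  by exists (r + q)./2; split=> [| |]; [lia | by [] | exists 1; lia].
have [r0 | r0] := posnP r.
  by exists q; split=> [| |]; [lia | by [] | exists 2; lia].
by exists r./2; split=> [| |]; [lia | by [] | exists 0; lia].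
Qed.

(** For odd [b], an odd [k] makes [b.-1 * m - 2 - k] odd too, and by [gen_even] neither has
    generators. *)
Lemma junction_index_even b m k : 1 < b -> odd b -> 0 < junction b m k ->
  k + 2 <= b.-1 * m -> ~~ odd k.
Proof.
move=> b1 ob; rewrite /junction => + km; rewrite km; apply: contraTN => ok.
rewrite !num_gen_odd // -subnDA oddB 1?addnC // !oddD ok oddM.
by have -> : odd b.-1 = false by lia.
Qed.

Lemma junction_le_exp b m c k : 1 < b -> 1 < junction b m k -> k + 2 <= b.-1 * m ->
  c < b -> (odd b -> c <= b.-1./2) -> c * (b ^ m + 1) + k <= b ^ m.+1.
Proof.
move=> b1 Jk km cb c_half; have bern := bernoulli m b1; rewrite expnS.
case: (boolP (odd b)) => ob.
  have {}c_half : c * 2 <= b.-1 by have := c_half ob; lia.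
  by nia.
(* This inequality is the worst case, [c = b.-1] and [k = b.-1 * m - 2]. *)
suff : b.-1 * m.+1 <= b ^ m + 2 by nia.
case: m Jk km {bern} => [|[|m]] Jk km; first by lia.
  (* For [m = 1] the inequality can fail, but [k] and [b - 3 - k] have opposite parities for even
     [b], so the junction has value 1 only. *)
  move: Jk; rewrite /junction km !num_gen_le_base //; try lia.
have := bernoulli m.+1 b1; rewrite (expnS b m.+1) => bern.
by nia.
Qed.

(** The value of a junction does not involve [c], which is thus free to select the class. The bound
    [b ^ m.+1] keeps the result at scale [m]. *)
Lemma exists_junction_residue b m k i : 1 < b -> 1 < junction b m k ->
  k + 2 <= b.-1 * m -> (odd b -> ~~ odd i) ->
  exists2 u, num_gen b u = junction b m k & u = i %[mod b.-1] /\ u <= b ^ m.+1.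
Proof.
move=> b1 Jk km oi.
have [|c [c_lt c_half cE]] := @exists_leading_digit b i k b1.
  by move=> ob; split; [exact: oi | exact: junction_index_even (ltnW Jk) km].
have [_ cb] := andP c_lt; have le_exp := junction_le_exp b1 Jk km cb c_half.
exists (c * (b ^ m + 1) + k); last by rewrite junction_residue.
by apply: num_gen_junction => //; have := bernoulli m b1; lia.
Qed.

(** * Existence of junctions and minimality *)

Lemma exists_junction b n : 1 < b -> 1 < n ->
  exists m k, k + 2 <= b.-1 * m /\ junction b m k = n.
Proof.
move=> b1; have num_gen0 : num_gen b 0 = 1 by rewrite num_gen_le_base.
(* A solution of [num_gen b u = n] with [u = -2 %[mod b.-1]] gives a junction at
   [k = 0] with value [num_gen b 0 + num_gen b u = n.+1]. *)
have step u l : num_gen b u = l -> b.-1 %| u + 2 ->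
    exists m k, k + 2 <= b.-1 * m /\ junction b m k = l.+1.
  move=> uE /dvdnP[m mE]; exists m, 0; rewrite add0n mulnC -mE leq_addl; split=> //.
  by rewrite /junction mulnC -mE add0n leq_addl addnK subn0 num_gen0 uE.
case: n => [|[|n]] // _; elim: n => [|n [m [k [km Jk]]]].
  case: (boolP (odd b)) => ob.
    (* For odd [b], [b - 3] is even and below [b], hence has one generator, and [b - 3 + 2] is
       [b.-1] itself. *)
    apply: (step (b - 3)); first by rewrite num_gen_le_base //; lia.
    by have -> : b - 3 + 2 = b.-1 by lia.
  (* For even [b], the even index [b - 2] is its own partner at scale 2, giving [1 + 1]. *)
  exists 2, (b - 2); have le2 : b - 2 + 2 <= b.-1 * 2 by lia.
  split=> //; rewrite /junction le2.
  have -> : b.-1 * 2 - 2 - (b - 2) = b - 2 by lia.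
  by rewrite num_gen_le_base //; lia.
(* [b.-1 * 2 - 2] is an even representative of the class of -2; the factor 2 prevents truncation
   when [b = 2]. *)
have [||u uE [ui _]] := @exists_junction_residue b m k (b.-1 * 2 - 2) b1 _ km.
- by rewrite Jk.
- by move=> _; lia.
rewrite Jk in uE.
apply: (step u) => //.
have : u + 2 = b.-1 * 2 %[mod b.-1].
  by rewrite -modnDml ui modnDml subnK //; lia.
by rewrite modnMr => /eqP.
Qed.

Lemma leastP (P : set nat) u : P u -> P (least P) /\ forall v, P v -> least P <= v.
Proof.
move=> Pu; have exP : exists v, `[< P v >] by exists u; apply/asboolP.
have [w /asboolP Pw w_min] := ex_minnP exP.
suff : [set u | P u /\ forall v, P v -> u <= v]%classic (least P) by [].
by apply: xgetPex; exists w; split=> // v /asboolP /w_min.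
Qed.

Lemma K_junction b n : 1 < b -> 1 < n -> exists k,
  [/\ k + 2 <= b.-1 * B b n, junction b (B b n) k = n & K b n = b ^ B b n + 1 + k].
Proof.
move=> b1 n1; have [m0 [k0 [km0 J0]]] := exists_junction b1 n1.
(* The class 0 is a convenient choice: only some number with [n] generators is wanted here, for
   [leastP]. *)
have [||v vE _] := @exists_junction_residue b m0 k0 0 b1 _ km0; rewrite ?J0 //.
rewrite J0 in vE.
have [uE u_min] := leastP (vE : [set u | num_gen b u = n]%classic v).
rewrite -/(K b n) /= in uE u_min; rewrite /B; set u := K b n in uE u_min *.
have u1 : 1 < u.
  by rewrite ltnNge; apply/negP => u1; move: uE; rewrite num_gen_le_base //; lia.
have [c [m [k [c_lt kb uck u_le]]]] := junction_decomposition b1 u1.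
have Jk : junction b m k = n by rewrite -uE uck num_gen_junction // -uck.
have km : k + 2 <= b.-1 * m.
  (* Outside this range the second summand of [junction] vanishes, so the smaller number [k] would
     itself have [n] generators. *)
  rewrite leqNgt; apply/negP => km.
  have kn : num_gen b k = n by rewrite -Jk /junction leqNgt km addn0.
  have := u_min k kn; rewrite uck leqNgt -{1}[k]add0n ltn_add2r muln_gt0 addn1.
  by case/andP: c_lt => ->.
(* Lowering the leading coefficient to 1 preserves the count, so minimality forces [c = 1]. *)
have := u_min (1 * (b ^ m + 1) + k); rewrite num_gen_junction ?mul1n //; last first.
  by rewrite (leq_trans _ u_le) // uck leq_add2r leq_pmull //; case/andP: c_lt.
move=> /(_ Jk) u_le1; have {uck}uck : u = b ^ m + 1 + k.
  by apply/eqP; rewrite eqn_leq u_le1 uck leq_add2r leq_pmull //; case/andP: c_lt.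
have -> : trunc_log b u = m; last by exists k.
apply: trunc_log_eq => //; have := bernoulli m b1; rewrite expnS uck; nia.
Qed.

Theorem theorem4p4 (b : nat) (hb : 2 <= b) (i : 'I_b.-1) (hi : i \in index_set b)
    (n : nat) (hn : 2 <= n) :
  exists c k : nat,
    [/\ 1 <= c <= b.-1,
        k + 2 <= b.-1 * B b n,
        Ki i n = c * (b ^ B b n + 1) + k
      & odd b -> c <= b.-1./2].
Proof.
have K_min v : num_gen b v = n -> K b n <= v.
  by move=> vE; have [_] := leastP (vE : [set u | num_gen b u = n]%classic v); apply.
have [k0 [km0 Jk0 KE]] := K_junction hb hn.
move: (B b n) km0 Jk0 KE => m km0 Jk0 KE.
have oi : odd b -> ~~ odd i by move: hi; rewrite inE => /implyP.
have [|v vE [vi v_le]] := exists_junction_residue hb _ km0 oi; first by rewrite Jk0.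
rewrite Jk0 in vE; pose P := [set u | num_gen b u = n /\ u = i %[mod b.-1]]%classic.
have vP : P v by []; have [uP u_min] := leastP vP; clear vE vi.
rewrite -/(Ki i n) in uP u_min; move: (Ki i n) uP u_min => u uP u_min.
have uE : num_gen b u = n by case: uP.
have K_le_u := K_min u uE.
have bm0 : 0 < b ^ m by rewrite expn_gt0 (ltnW hb).
have [|c [m' [k [c_lt kb uck u_le]]]] := @junction_decomposition b u hb; first by lia.
have Jk : junction b m' k = n by rewrite -uE uck num_gen_junction // -uck.
(* A larger scale would give [v <= b ^ m.+1 <= b ^ m' < u], against the minimality of [u]. *)
have m'_le_m : m' <= m.
  rewrite leqNgt -(leq_exp2l _ _ hb); apply/negP => le_exp.
  have := leq_trans (u_min v vP) v_le; apply/negP; rewrite -ltnNge uck.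
  case/andP: c_lt => c0 _; rewrite (leq_ltn_trans le_exp) // ltn_addr //.
  by rewrite (@leq_trans (b ^ m' + 1)) ?addn1 ?leq_pmull.
(* Otherwise [k] has [n] generators, yet [k <= b ^ m' <= b ^ m < K b n]. *)
have km' : k + 2 <= b.-1 * m'.
  rewrite leqNgt; apply/negP => km.
  have kn : num_gen b k = n by rewrite -Jk /junction leqNgt km addn0.
  by have := K_min k kn; move: m'_le_m; rewrite -(leq_exp2l _ _ hb); lia.
have bern := bernoulli m' hb.
(* At a smaller scale, replacing [c] by 1 gives a number with [n] generators below
   [2 * b ^ m' <= b ^ m < K b n]. *)
have m_le_m' : m <= m'.
  rewrite leqNgt -(leq_exp2l _ _ hb); apply/negP; rewrite expnS => le_exp.
  have := K_min (1 * (b ^ m' + 1) + k).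
  rewrite mul1n -{1}[_ + 1]mul1n num_gen_junction ?mul1n //; last first.
    by rewrite (leq_trans _ u_le) // uck leq_add2r leq_pmull //; case/andP: c_lt.
  by move=> /(_ Jk); have := leq_mul hb (leqnn (b ^ m')); lia.
have mE : m' = m by apply/eqP; rewrite eqn_leq m'_le_m.
subst m'; exists c, k; split=> //; first by lia.
(* For odd [b], [b.-1] divides [b.-1./2 * (b ^ m + 1)]. *)
move=> ob; rewrite leqNgt; apply/negP => c_gt.
pose d := c - b.-1./2; have cE : c = b.-1./2 + d by rewrite /d; lia.
have du : d * (b ^ m + 1) + k < u.
  by rewrite uck ltn_add2r ltn_pmul2r ?addn1 // /d; lia.
suff dP : P (d * (b ^ m + 1) + k) by have := u_min _ dP; rewrite leqNgt du.
split.
  by rewrite num_gen_junction //; [rewrite /d; lia | apply: leq_trans (ltnW du) u_le].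
case: uP => _ <-; rewrite uck !junction_residue // cE.
have -> : (b.-1./2 + d) * 2 + k = 1 * b.-1 + (d * 2 + k) by lia.
by rewrite modnMDl.
Qed.
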